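(* Let $0 < p < \infty$ and suppose that $(\Omega, \mu)$ is a measure space. Let $(X,d)$ be a metric space that has strict $q$-negative type for some $q \geq p$. Then $(X,d)$ is not isometric to any metric subspace of $L_{p}(\Omega, \mu)$ that admits a virtually degenerate simplex. In particular: (1) $(X,d)$ is not isometric to any linear subspace $W$ of $L_{p}(\Omega, \mu)$ that contains a pair of disjointly supported non-zero vectors, and (2) $(X,d)$ is not isometric to any metric subspace of $L_{p}(\Omega, \mu)$ that has non-empty interior.
   Context: All measures are non-trivial and positive. $L_{p}(\Omega,\mu)$ is real or complex, carries the usual (quasi-)norm $\|f\|_p = (\int_\Omega |f|^p\,d\mu)^{1/p}$, and is assumed to be at least two-dimensional. Subsets of $L_p(\Omega,\mu)$ carry the distance $\|x-y\|_p$ (a quasi-metric when $p<1$), and ''isometric'' means that there is a distance-preserving bijection. Let $q>0$. A metric space $(X,d)$ has $q$-negative type if for all finite sets of distinct points $\{z_1,\ldots,z_n\}\subseteq X$ and all real $\alpha_1,\ldots,\alpha_n$ with $\alpha_1+\cdots+\alpha_n=0$ we have $\sum_{j,i=1}^n d(z_j,z_i)^q\alpha_j\alpha_i\le 0$; it has strict $q$-negative type if moreover this inequality is strict unless $\alpha_1=\cdots=\alpha_n=0$. A signed $(s,t)$-simplex in a set $X$ ($s,t>0$ integers) is a collection of (not necessarily distinct) points $x_{1},\ldots,x_{s},y_{1},\ldots,y_{t}\in X$ together with real numbers $m_{1},\ldots,m_{s},n_{1},\ldots,n_{t}$ satisfying $m_{1}+\cdots+m_{s}=n_{1}+\cdots+n_{t}$;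 it is denoted $D=[x_{j}(m_{j});y_{i}(n_{i})]_{s,t}$. Let $S(D)=\{x_1,\ldots,x_s\}\cup\{y_1,\ldots,y_t\}$. For $z\in S(D)$ put $\mathbf{m}(z)=\sum_{j:x_j=z}m_j$ and $\mathbf{n}(z)=\sum_{i:y_i=z}n_i$ (empty sums are $0$). $D$ is degenerate if $\mathbf{m}(z)=\mathbf{n}(z)$ for all $z\in S(D)$. A non-degenerate signed simplex $D=[x_{j}(m_{j});y_{i}(n_{i})]_{s,t}$ in $L_p(\Omega,\mu)$ is virtually degenerate if for $\mu$-almost every $\omega\in\Omega$ the signed simplex $D(\omega)=[x_{j}(\omega)(m_{j});y_{i}(\omega)(n_{i})]_{s,t}$ in the scalar field is degenerate. A subset $Z$ admits a virtually degenerate simplex if there is a virtually degenerate simplex all of whose points lie in $Z$. *)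

(* Defs.v *)
From HB Require Import structures.
From mathcomp Require Import all_boot all_order all_algebra.
From mathcomp Require Import complex.
From mathcomp Require Import all_classical all_reals all_analysis.
From mathcomp Require Import measurable_realfun.

Set Implicit Arguments.
Unset Strict Implicit.
Unset Printing Implicit Defensive.

Import Order.TTheory GRing.Theory Num.Theory.
Import numFieldNormedType.Exports.

Local Open Scope classical_set_scope.
Local Open Scope ring_scope.

Section negative_type.
Context {R : realType}.

Definition negative_type (X : metricType R) (q : R) : Prop :=
  forall (n : nat) (z : 'I_n -> X) (alpha : 'I_n -> R),
    injective z -> \sum_(i < n) alpha i = 0 ->
    \sum_(j < n) \sum_(i < n)
      mdist (z j) (z i) `^ q * alpha j * alpha i <= 0.

Definition strict_negative_type (X : metricType R) (q : R) : Prop :=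
  negative_type X q /\
  forall (n : nat) (z : 'I_n -> X) (alpha : 'I_n -> R),
    injective z -> \sum_(i < n) alpha i = 0 ->
    ~ (forall i, alpha i = 0) ->
    \sum_(j < n) \sum_(i < n)
      mdist (z j) (z i) `^ q * alpha j * alpha i < 0.

End negative_type.

Record signed_simplex (R : realType) (X : eqType) := SignedSimplex {
  splx_s : nat;
  splx_t : nat;
  splx_x : 'I_splx_s -> X;
  splx_y : 'I_splx_t -> X;
  splx_m : 'I_splx_s -> R;
  splx_n : 'I_splx_t -> R;
  splx_s_gt0 : (0 < splx_s)%N;
  splx_t_gt0 : (0 < splx_t)%N;
  splx_balanced : \sum_j splx_m j = \sum_i splx_n i
}.

Section signed_simplex_theory.
Context {R : realType}.

Definition splx_points (X : eqType) (D : signed_simplex R X) : set X :=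
  range (splx_x (s := D)) `|` range (splx_y (s := D)).

Definition splx_mweight (X : eqType) (D : signed_simplex R X) (z : X) : R :=
  \sum_(j | splx_x j == z) splx_m (s := D) j.

Definition splx_nweight (X : eqType) (D : signed_simplex R X) (z : X) : R :=
  \sum_(i | splx_y i == z) splx_n (s := D) i.

Definition degenerate (X : eqType) (D : signed_simplex R X) : Prop :=
  forall z, splx_points D z -> splx_mweight D z = splx_nweight D z.

Definition splx_map (X Y : eqType) (f : X -> Y) (D : signed_simplex R X) :
    signed_simplex R Y :=
  SignedSimplex (fun j => f (splx_x j)) (fun i => f (splx_y i))
    (splx_s_gt0 D) (splx_t_gt0 D) (splx_balanced D).

End signed_simplex_theory.

Inductive scalar_kind := RealScalars | ComplexScalars.

Definition scalar (R : realType) (F : scalar_kind) : numFieldType :=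
  match F with
  | RealScalars => R
  | ComplexScalars => R[i]
  end.

(* The norm [`|z|] on [R[i]] is itself [R[i]]-valued, hence [normc]. *)
Definition modulus (R : realType) (F : scalar_kind) : scalar R F -> R :=
  match F with
  | RealScalars => fun x : R => `|x|
  | ComplexScalars => fun z : R[i] => ComplexField.Normc.normc z
  end.

Definition scalar_measurable (R : realType) (F : scalar_kind)
    (d : measure_display) (T : measurableType d) :
    (T -> scalar R F) -> Prop :=
  match F with
  | RealScalars => fun f : T -> R => measurable_fun [set: T] f
  | ComplexScalars => fun f : T -> R[i] =>
      measurable_fun [set: T] (fun w => complex.Re (f w)) /\
      measurable_fun [set: T] (fun w => complex.Im (f w))
  end.

Section scalar_lemmas.
Context (R : realType) (F : scalar_kind) d (T : measurableType d).
Implicit Types (x y : scalar R F) (f g : T -> scalar R F).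

Lemma modulus_ge0 x : 0 <= modulus x.
Proof. by case: F x => [x|[a b]] /=; [exact: normr_ge0|exact: sqrtr_ge0]. Qed.

Lemma modulus0 : modulus (0 : scalar R F) = 0.
Proof. by case: F => /=; [exact: normr0|exact: ComplexField.Normc.normc0]. Qed.

Lemma modulusM x y : modulus (x * y) = modulus x * modulus y.
Proof.
by case: F x y => x y /=; [exact: normrM|exact: ComplexField.Normc.normcM].
Qed.

Lemma modulusD x y : modulus (x + y) <= modulus x + modulus y.
Proof.
case: F x y => x y /=; first exact: ler_normD.
have := ler_normD (x : R[i]) y; rewrite !normc_def.
by case: x y => [a b] [c e]; rewrite /= lecE /= => /andP[].
Qed.

Lemma scalar_measurable_cst x : scalar_measurable (fun _ : T => x).
Proof. by case: F x => x /=; [|split]; exact: measurable_cst. Qed.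

Lemma scalar_measurableD f g : scalar_measurable f -> scalar_measurable g ->
  scalar_measurable (fun w => f w + g w).
Proof.
case: F f g => /= f g; first exact: measurable_funD.
move=> [f1 f2] [g1 g2]; split.
- rewrite (_ : (fun _ => _) =
    (fun w => complex.Re (f w) + complex.Re (g w))); last first.
    by apply/funext => w; case: (f w) (g w) => ? ? [].
  exact: measurable_funD.
- rewrite (_ : (fun _ => _) =
    (fun w => complex.Im (f w) + complex.Im (g w))); last first.
    by apply/funext => w; case: (f w) (g w) => ? ? [].
  exact: measurable_funD.
Qed.

Lemma scalar_measurableZ x f : scalar_measurable f ->
  scalar_measurable (fun w => x * f w).
Proof.
case: F x f => /= [x f mf|[a b] f [f1 f2]].
  by apply: measurable_funM => //; exact: measurable_cst.
split.
- rewrite (_ : (fun _ => _) =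
    (fun w => a * complex.Re (f w) - b * complex.Im (f w))); last first.
    by apply/funext => w; case: (f w).
  by apply: measurable_funB; apply: measurable_funM => //;
    exact: measurable_cst.
- rewrite (_ : (fun _ => _) =
    (fun w => a * complex.Im (f w) + b * complex.Re (f w))); last first.
    by apply/funext => w; case: (f w).
  by apply: measurable_funD; apply: measurable_funM => //;
    exact: measurable_cst.
Qed.

Lemma measurable_modulus f : scalar_measurable f ->
  measurable_fun [set: T] (fun w => modulus (f w)).
Proof.
case: F f => /= [f mf|f [f1 f2]].
  exact: (measurableT_comp (@normr_measurable R setT)).
rewrite (_ : (fun _ => _) = (fun w => Num.sqrt
    (complex.Re (f w) ^+ 2 + complex.Im (f w) ^+ 2))); last first.
  by apply/funext => w; case: (f w).
under eq_fun do rewrite -powR12_sqrt ?addr_ge0 ?sqr_ge0//.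
apply: (@measurableT_comp _ _ _ _ _ _ (@powR R ^~ 2^-1)) => //.
by apply: measurable_funD; exact: measurable_funX.
Qed.

End scalar_lemmas.

Section Lp_functions.
Context (R : realType) (F : scalar_kind) d (T : measurableType d).
Variables (mu : {measure set T -> \bar R}) (p : R).

(* [LspaceType] only covers real scalars and exponents [1 <= p]. *)
Record Lp_function := LpFunction {
  Lp_function_fun :> T -> scalar R F;
  Lp_function_measurable : scalar_measurable Lp_function_fun;
  Lp_function_finite : finite_norm mu p%:E (@modulus R F \o Lp_function_fun)
}.

HB.instance Definition _ := gen_eqMixin Lp_function.
HB.instance Definition _ := gen_choiceMixin Lp_function.

Definition Lp_ae_eq (f g : Lp_function) : bool :=
  `[< {ae mu, forall w, f w = g w} >].

Let Lp_ae_eq_refl : reflexive Lp_ae_eq.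
Proof. by move=> f; apply/asboolP; apply: aeW. Qed.

Let Lp_ae_eq_sym : symmetric Lp_ae_eq.
Proof.
by move=> f g; apply/idP/idP => /asboolP h; apply/asboolP; near do symmetry.
Unshelve. all: by end_near. Qed.

Let Lp_ae_eq_trans : transitive Lp_ae_eq.
Proof.
move=> g f h /asboolP fg /asboolP gh; apply/asboolP.
by apply: filterS2 fg gh => w ->.
Qed.

Canonical Lp_ae_eq_equiv :=
  EquivRel Lp_ae_eq Lp_ae_eq_refl Lp_ae_eq_sym Lp_ae_eq_trans.

Lemma finite_normE (h : T -> R) : p != 0 -> (forall w, 0 <= h w) ->
  finite_norm mu p%:E h <-> (\int[mu]_w (h w `^ p)%:E < +oo)%E.
Proof.
move=> p0 h0; rewrite /finite_norm.
have -> : (\int[mu]_w (h w `^ p)%:E = 'N[mu]_p%:E[EFin \o h] `^ p)%E.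
  rewrite poweR_Lnorm//; apply: eq_integral => w _ /=.
  by rewrite ger0_norm.
by split; [exact: poweR_lty|exact: lty_poweRy].
Qed.

Hypothesis p0 : 0 < p.

Lemma finite_norm_modulusP (f : T -> scalar R F) :
  finite_norm mu p%:E (@modulus R F \o f) <->
  (\int[mu]_w (modulus (f w) `^ p)%:E < +oo)%E.
Proof. by apply: finite_normE => [|w]; [rewrite gt_eqF|exact: modulus_ge0]. Qed.

Lemma measurable_modulus_powR (f : T -> scalar R F) : scalar_measurable f ->
  measurable_fun [set: T] (fun w => (modulus (f w) `^ p)%:E).
Proof.
move=> mf; apply/measurable_EFinP.
apply: (@measurableT_comp _ _ _ _ _ _ (@powR R ^~ p)) => //.
exact: measurable_modulus.
Qed.

Lemma Lp_function_finite0 :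
  finite_norm mu p%:E (@modulus R F \o (fun _ : T => 0)).
Proof.
apply/finite_norm_modulusP; rewrite integral0_eq// => w _.
by rewrite modulus0 powR0// gt_eqF.
Qed.

Definition Lp_function0 : Lp_function :=
  LpFunction (scalar_measurable_cst T 0) Lp_function_finite0.

Lemma Lp_function_finiteD (f g : Lp_function) :
  finite_norm mu p%:E (@modulus R F \o (fun w => f w + g w)).
Proof.
case: f g => f mf /finite_norm_modulusP ff [g mg /finite_norm_modulusP fg] /=.
apply/finite_norm_modulusP.
pose h w := (2 `^ p * (modulus (f w) `^ p + modulus (g w) `^ p)).
apply: (@le_lt_trans _ _ (\int[mu]_w (h w)%:E)%E).
  apply: ge0_le_integral => //.
  - by move=> w _; rewrite lee_fin powR_ge0.
  - exact: measurable_modulus_powR (scalar_measurableD mf mg).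
  - apply/measurable_EFinP; apply: measurable_funM => //.
    by apply: measurable_funD; apply/measurable_EFinP;
      exact: measurable_modulus_powR.
  move=> w _; rewrite lee_fin /h.
  set a := modulus (f w); set b := modulus (g w).
  have a0 : 0 <= a by exact: modulus_ge0.
  have b0 : 0 <= b by exact: modulus_ge0.
  have m0 : 0 <= Num.max a b by rewrite le_max a0.
  apply: (@le_trans _ _ ((2 * Num.max a b) `^ p)).
    apply: ge0_ler_powR; rewrite ?nnegrE ?modulus_ge0 ?mulr_ge0 ?(ltW p0)//.
    apply: le_trans (modulusD _ _) _; rewrite mulr_natl mulr2n.
    by apply: lerD; rewrite le_max lexx ?orbT.
  rewrite powRM// ler_wpM2l ?powR_ge0//.
  by case: (leP a b) => _; rewrite ?lerDr ?lerDl powR_ge0.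
under eq_integral do rewrite EFinM.
rewrite ge0_integralZl//; last 2 first.
- apply/measurable_EFinP.
  by apply: measurable_funD; apply/measurable_EFinP;
    exact: measurable_modulus_powR.
- by move=> w _; rewrite lee_fin addr_ge0 ?powR_ge0.
under eq_integral do rewrite EFinD.
rewrite ge0_integralD//; last 4 first.
- by move=> w _; rewrite lee_fin powR_ge0.
- exact: measurable_modulus_powR.
- by move=> w _; rewrite lee_fin powR_ge0.
- exact: measurable_modulus_powR.
by apply: lte_mul_pinfty; rewrite ?lee_fin ?powR_ge0// lte_add_pinfty.
Qed.

Definition Lp_functionD (f g : Lp_function) : Lp_function :=
  LpFunction
    (scalar_measurableD (Lp_function_measurable f) (Lp_function_measurable g))
    (Lp_function_finiteD f g).

Lemma Lp_function_finiteZ (a : scalar R F) (f : Lp_function) :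
  finite_norm mu p%:E (@modulus R F \o (fun w => a * f w)).
Proof.
case: f => f mf /finite_norm_modulusP ff /=; apply/finite_norm_modulusP.
under eq_integral do rewrite modulusM powRM ?modulus_ge0// EFinM.
rewrite ge0_integralZl//; last 3 first.
- exact: measurable_modulus_powR.
- by move=> w _; rewrite lee_fin powR_ge0.
- by rewrite lee_fin powR_ge0.
by apply: lte_mul_pinfty; rewrite ?lee_fin ?powR_ge0.
Qed.

Definition Lp_functionZ (a : scalar R F) (f : Lp_function) : Lp_function :=
  LpFunction (scalar_measurableZ a (Lp_function_measurable f))
    (Lp_function_finiteZ a f).

End Lp_functions.

Section Lp_space.
Context (R : realType) (F : scalar_kind) d (T : measurableType d).
Variables (mu : {measure set T -> \bar R}) (p : R) (p0 : 0 < p).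
Local Open Scope quotient_scope.

(* [p0] does not occur in the quotient; it is what makes [Lp] a vector space. *)
Definition Lp of 0 < p : Type := {eq_quot @Lp_ae_eq R F d T mu p}.

Local Notation LP := (Lp p0).
Local Notation fn := (Lp_function F mu p).

HB.instance Definition _ := Choice.on LP.
HB.instance Definition _ := EqQuotient.on LP.

(* The value at [w] depends on the representative chosen by [repr]; statements
   about it are meaningful only up to a [mu]-negligible set of [w]. *)
Definition Lp_fun (x : LP) : T -> scalar R F := (repr x : fn).

Coercion Lp_fun : LP >-> Funclass.

Lemma Lp_eqP (x y : LP) : x = y <-> {ae mu, forall w, x w = y w}.
Proof.
split=> [->|xy]; first exact: aeW.
by rewrite -[x]reprK -[y]reprK; apply/eqmodP/asboolP.
Qed.

Lemma Lp_piE (f : fn) : {ae mu, forall w, (\pi f : LP) w = f w}.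
Proof. by have /eqmodP/asboolP := reprK (\pi_LP f). Qed.

Definition Lp_zero : LP := \pi_LP (Lp_function0 F mu p0).
Definition Lp_add (x y : LP) : LP := \pi_LP (Lp_functionD p0 (repr x) (repr y)).
Definition Lp_scale (a : scalar R F) (x : LP) : LP :=
  \pi_LP (Lp_functionZ p0 a (repr x)).
Definition Lp_opp (x : LP) : LP := Lp_scale (- 1) x.

Let zeroE : \forall w \ae mu, Lp_zero w = 0. Proof. exact: Lp_piE. Qed.

Let addE x y : \forall w \ae mu, Lp_add x y w = x w + y w.
Proof. exact: Lp_piE. Qed.

Let scaleE a x : \forall w \ae mu, Lp_scale a x w = a * x w.
Proof. exact: Lp_piE. Qed.

Let oppE x : \forall w \ae mu, Lp_opp x w = - x w.
Proof. by apply: filterS (scaleE (- 1) x) => w ->; rewrite mulN1r. Qed.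

Let Lp_addA : associative Lp_add.
Proof.
move=> x y z; apply/Lp_eqP.
apply: filterS2 (filterI (addE x (Lp_add y z)) (addE y z))
  (filterI (addE (Lp_add x y) z) (addE x y)) => w [-> ->] [-> ->].
by rewrite addrA.
Qed.

Let Lp_addC : commutative Lp_add.
Proof.
move=> x y; apply/Lp_eqP.
by apply: filterS2 (addE x y) (addE y x) => w -> ->; rewrite addrC.
Qed.

Let Lp_add0 : left_id Lp_zero Lp_add.
Proof.
move=> x; apply/Lp_eqP.
by apply: filterS2 (addE Lp_zero x) zeroE => w -> ->; rewrite add0r.
Qed.

Let Lp_addN : left_inverse Lp_zero Lp_opp Lp_add.
Proof.
move=> x; apply/Lp_eqP; apply: filterS3 (addE (Lp_opp x) x) (oppE x) zeroE.
by move=> w -> -> ->; rewrite addNr.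
Qed.

HB.instance Definition _ :=
  GRing.isZmodule.Build LP Lp_addA Lp_addC Lp_add0 Lp_addN.

Let Lp_scaleA a b x : Lp_scale a (Lp_scale b x) = Lp_scale (a * b) x.
Proof.
apply/Lp_eqP.
apply: filterS3 (scaleE a (Lp_scale b x)) (scaleE b x) (scaleE (a * b) x).
by move=> w -> -> ->; rewrite mulrA.
Qed.

Let Lp_scale1 : left_id 1 Lp_scale.
Proof.
by move=> x; apply/Lp_eqP; apply: filterS (scaleE 1 x) => w ->; rewrite mul1r.
Qed.

Let Lp_scaleDr : right_distributive Lp_scale +%R.
Proof.
move=> a x y; apply/Lp_eqP.
apply: filterS3 (filterI (scaleE a (x + y)) (addE x y))
  (addE (Lp_scale a x) (Lp_scale a y)) (filterI (scaleE a x) (scaleE a y)).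
by move=> w [-> ->] -> [-> ->]; rewrite mulrDr.
Qed.

Let Lp_scaleDl x : {morph Lp_scale^~ x : a b / a + b}.
Proof.
move=> a b; apply/Lp_eqP.
apply: filterS3 (scaleE (a + b) x) (addE (Lp_scale a x) (Lp_scale b x))
  (filterI (scaleE a x) (scaleE b x)).
by move=> w -> -> [-> ->]; rewrite mulrDl.
Qed.

HB.instance Definition _ := GRing.Zmodule_isLmodule.Build (scalar R F) LP
  Lp_scaleA Lp_scale1 Lp_scaleDr Lp_scaleDl.

Lemma Lp_zeroE : \forall w \ae mu, (0 : LP) w = 0.
Proof. exact: zeroE. Qed.

Lemma Lp_addE (x y : LP) : \forall w \ae mu, (x + y : LP) w = x w + y w.
Proof. exact: addE. Qed.

Lemma Lp_oppE (x : LP) : \forall w \ae mu, (- x : LP) w = - x w.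
Proof. exact: oppE. Qed.

Lemma Lp_scaleE (a : scalar R F) (x : LP) :
  \forall w \ae mu, (a *: x : LP) w = a * x w.
Proof. exact: scaleE. Qed.

Definition Lp_norm (x : LP) : R :=
  fine ('N[mu]_p%:E[EFin \o (@modulus R F \o x)])%E.

Definition Lp_dist (x y : LP) : R := Lp_norm (x - y).

Definition Lp_open (U : set LP) : Prop := forall x, U x ->
  exists2 e : R, 0 < e & [set y | Lp_dist x y < e] `<=` U.

Let Lp_openT : Lp_open setT. Proof. by move=> x _; exists 1. Qed.

Let Lp_openI : setI_closed Lp_open.
Proof.
move=> A B oA oB x [/oA[a a0 aA] /oB[b b0 bB]].
exists (Num.min a b) => [|y]; first by rewrite lt_min a0.
by rewrite /= lt_min => /andP[ya yb]; split; [exact: aA|exact: bB].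
Qed.

Let Lp_open_bigU (I : Type) (f : I -> set LP) :
  (forall i, Lp_open (f i)) -> Lp_open (\bigcup_i f i).
Proof.
move=> of_ x [i _ fix_]; have [e e0 ef] := of_ i x fix_.
by exists e => // y /ef fiy; exists i.
Qed.

HB.instance Definition _ :=
  isOpenTopological.Build LP Lp_openT Lp_openI Lp_open_bigU.

Lemma Lp_openE : @open LP = Lp_open.
Proof. by []. Qed.

End Lp_space.

Arguments Lp {R} F {d T} mu {p} _.

Section Lp_subsets.
Context (R : realType) (F : scalar_kind) d (T : measurableType d).
Variables (mu : {measure set T -> \bar R}) (p : R) (p0 : 0 < p).

Definition virtually_degenerate (D : signed_simplex R (Lp F mu p0)) : Prop :=
  ~ degenerate D /\
  {ae mu, forall w, degenerate (splx_map (fun x : Lp F mu p0 => x w) D)}.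

Definition admits_virtually_degenerate (Z : set (Lp F mu p0)) : Prop :=
  exists2 D : signed_simplex R (Lp F mu p0),
    virtually_degenerate D & splx_points D `<=` Z.

Definition isometric_to (X : metricType R) (Z : set (Lp F mu p0)) : Prop :=
  exists2 f : X -> Lp F mu p0, set_bij [set: X] Z f &
    forall x y, Lp_dist (f x) (f y) = mdist x y.

Definition disjointly_supported (x y : Lp F mu p0) : Prop :=
  {ae mu, forall w, x w = 0 \/ y w = 0}.

End Lp_subsets.

Definition at_least_two_dimensional (K : fieldType) (V : lmodType K) : Prop :=
  exists x y : V, forall a b : K, a *: x + b *: y = 0 -> a = 0 /\ b = 0.

(* Main.v *)
Require Import Defs.
From mathcomp Require Import all_boot all_order all_algebra.
From mathcomp Require Import complex.
From mathcomp Require Import all_classical all_reals all_analysis.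
From mathcomp Require Import measurable_realfun.
From mathcomp Require Import ring lra.

(** Strict q-negative type passes down to every exponent [p <= q], so it is
    enough to contradict strict p-negative type. For a virtually degenerate
    simplex with weights [c z], the sum of the [|z - z'|_p ^ p * c z * c z'] is
    the integral of the same sum for the values [z w] in the scalar field, which
    vanishes for almost every [w] because equal values carry total weight zero.

    For the passage from [k = d ^ q] to [k ^ a] with [0 < a <= 1], border [k]
    with a row and a column of ones. Strict negativity of [k] on the vectors of
    sum zero says that the bordered kernel is Lorentzian, so it equals
    [x i * x j * (1 - P i j)] up to a positive factor, with [x i] the row sums
    and [P] positive semidefinite with entries in [[-1, 1]]. In
    [(1 - t) ^ a = 1 - a t - ...] all further coefficients are nonpositive, and
    entrywise powers of [P] are positive semidefinite by Schur's theorem, so on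
    vectors orthogonal to [x ^ a] the power of the kernel is bounded by
    [- a P < 0]. The border entry provides the freedom needed to reach
    orthogonality.

    If [u] and [v] are disjointly supported, then [x + u, x + v] against
    [x, x + (u + v)] is virtually degenerate. Such [u] and [v] exist in every
    at least two-dimensional L_p: otherwise each measurable set is null or
    conull on the support of two given functions, which are then constant there,
    hence proportional. *)

Set Implicit Arguments.
Unset Strict Implicit.
Unset Printing Implicit Defensive.

Import Order.TTheory GRing.Theory Num.Theory.
Import numFieldNormedType.Exports.

Local Open Scope classical_set_scope.
Local Open Scope ring_scope.

(** * Positive semidefinite kernels on a finite set and Schur's product theorem *)

Section quadratic_forms.
Context {R : realType} {I : finType}.
Implicit Types (P Q : I -> I -> R) (x y : I -> R).

Definition quad P x : R := \sum_i \sum_j P i j * x i * x j.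

Definition psd P := (forall i j, P i j = P j i) /\ (forall x, 0 <= quad P x).

Lemma quadD P Q x : quad (fun i j => P i j + Q i j) x = quad P x + quad Q x.
Proof.
rewrite /quad -big_split; apply: eq_bigr => i _ /=.
by rewrite -big_split; apply: eq_bigr => j _; rewrite !mulrDl.
Qed.

Lemma quadZ c P x : quad (fun i j => c * P i j) x = c * quad P x.
Proof.
rewrite /quad mulr_sumr; apply: eq_bigr => i _.
by rewrite mulr_sumr; apply: eq_bigr => j _; rewrite !mulrA.
Qed.

Lemma quadB P Q x : quad (fun i j => P i j - Q i j) x = quad P x - quad Q x.
Proof.
rewrite -mulN1r -quadZ -quadD; congr quad.
by apply/funext => i; apply/funext => j; rewrite mulN1r.
Qed.

Lemma quad_rank1 y x : quad (fun i j => y i * y j) x = (\sum_i y i * x i) ^+ 2.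
Proof.
rewrite /quad expr2 mulr_suml; apply: eq_bigr => i _.
by rewrite mulr_sumr; apply: eq_bigr => j _; rewrite mulrACA !mulrA.
Qed.

Lemma quad_scale P y x :
  quad (fun i j => y i * y j * P i j) x = quad P (fun i => y i * x i).
Proof.
by apply: eq_bigr => i _; apply: eq_bigr => j _; ring.
Qed.

Lemma quad_shift P x i0 t : (forall i j, P i j = P j i) ->
  quad P (fun i => x i + t * (i == i0)%:R) =
  quad P x + t * (\sum_i P i i0 * x i) *+ 2 + t ^+ 2 * P i0 i0.
Proof.
move=> Psym.
have delta (f : I -> R) : \sum_i f i * (i == i0)%:R = f i0.
  rewrite (bigD1 i0)//= eqxx mulr1 big1 ?addr0// => i /negPf ->.
  by rewrite mulr0.
transitivity (\sum_i (\sum_j P i j * x i * x j + t * (P i i0 * x i) +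
    (t * (\sum_j P i j * x j) + t ^+ 2 * P i i0) * (i == i0)%:R)).
  apply: eq_bigr => i _.
  rewrite -[P i i0 * x i]mulr1 -[P i i0](delta (P i)) -[RHS]addr0.
  transitivity (\sum_j (P i j * x i * x j + t * x i * (P i j * (j == i0)%:R) +
     (t * (P i j * x j) * (i == i0)%:R +
      t ^+ 2 * (P i j * (j == i0)%:R) * (i == i0)%:R))).
    by apply: eq_bigr => j _; ring.
  rewrite !big_split /= -!mulr_suml -!mulr_sumr (delta (P i)); ring.
rewrite !big_split /= delta -mulr_sumr /quad.
under [X in _ + (t * X + _)]eq_bigr do rewrite Psym.
ring.
Qed.

Lemma quad_delta P i : quad P (fun k => (k == i)%:R) = P i i.
Proof.
rewrite /quad (bigD1 i)//= [X in _ + X]big1 => [|k /negPf ki]; last first.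
  by apply: big1 => j _; rewrite ki mulr0 mul0r.
rewrite (bigD1 i)//= big1 => [|k /negPf ->]; last by rewrite mulr0.
by rewrite eqxx !mulr1 !addr0.
Qed.

(** Cauchy-Schwarz between [x] and the basis vector [e] at [i0]: the form at [x + t e] is a
    polynomial in [t] of degree at most two without negative values. *)
Lemma psd_row_sq P x i0 : psd P ->
  (\sum_i P i i0 * x i) ^+ 2 <= P i0 i0 * quad P x.
Proof.
move=> [Psym P0].
set L := \sum_i _.
have H t : 0 <= quad P x + t * L *+ 2 + t ^+ 2 * P i0 i0.
  by rewrite -quad_shift.
have p0 : 0 <= P i0 i0 by rewrite -quad_delta.
have [p00|pn0] := eqVneq (P i0 i0) 0.
  have [->|L0] := eqVneq L 0; first by rewrite expr0n/= p00 mul0r.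
  (* The polynomial is affine here, and this [t] would give it the value [-1]. *)
  have := H (- (quad P x + 1) / (2 * L)).
  rewrite p00 mulr0 addr0 (_ : _ *+ 2 = - (quad P x + 1)); last by field.
  lra.
have {p0 pn0} p0 : 0 < P i0 i0 by rewrite lt_neqAle eq_sym pn0.
(* The minimiser of the polynomial. *)
have := H (- L / P i0 i0).
rewrite (_ : _ + _ = quad P x - L ^+ 2 / P i0 i0); last first.
  by field; rewrite gt_eqF.
by rewrite subr_ge0 ler_pdivrMr// mulrC.
Qed.

Lemma psd_diag P i : psd P -> 0 <= P i i.
Proof. by move=> [_ P0]; rewrite -quad_delta. Qed.

Lemma psd_offdiag P i j : psd P -> P i j ^+ 2 <= P i i * P j j.
Proof.
move=> psdP; have := psd_row_sq (fun k => (k == j)%:R) i psdP.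
rewrite quad_delta (bigD1 j)//= eqxx mulr1 big1 => [|k /negPf ->]; last first.
  by rewrite mulr0.
by case: psdP => Psym _; rewrite addr0 Psym.
Qed.

(* Cholesky: eliminating one non-zero diagonal entry at a time. *)
Lemma psd_sum_rank1 P : psd P ->
  exists s : seq (I -> R), forall i j, P i j = \sum_(v <- s) v i * v j.
Proof.
have [n] := ubnP #|[pred i | P i i != 0]|.
elim: n P => // n IH P /ltnSE leP psdP; have [Psym P0] := psdP.
have [/existsP[i0 pi0]|/existsPn Pd] := boolP [exists i, P i i != 0];
  last first.
  exists [::] => i j; rewrite big_nil.
  have /negPn/eqP Pii := Pd i; have := psd_offdiag i j psdP.
  rewrite Pii mul0r => Pij; apply/eqP.
  by rewrite -sqrf_eq0 eq_le Pij sqr_ge0.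
have p0 : 0 < P i0 i0 by rewrite lt_neqAle eq_sym pi0 psd_diag.
pose v i := P i i0 / Num.sqrt (P i0 i0).
have vE i j : v i * v j = P i i0 * P j i0 / P i0 i0.
  rewrite /v mulrACA -invfM -expr2 sqr_sqrtr//; exact: ltW.
pose P' i j := P i j - v i * v j.
have psdP' : psd P'.
  split=> [i j|x]; first by rewrite /P' Psym mulrC.
  rewrite /P' quadB quad_rank1 subr_ge0.
  have -> : \sum_i v i * x i = (\sum_i P i i0 * x i) / Num.sqrt (P i0 i0).
    by rewrite mulr_suml; apply: eq_bigr => i _; rewrite /v mulrAC.
  rewrite expr_div_n sqr_sqrtr ?(ltW p0)// ler_pdivrMr// mulrC.
  exact: psd_row_sq.
have [|s sP'] := IH P' _ psdP'.
  (* The diagonal of [P'] vanishes wherever that of [P] does, and also at [i0]. *)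
  apply: leq_trans leP; apply: proper_card; apply/properP; split.
    apply/fintype.subsetP => i; rewrite !inE; apply: contra => /eqP Pii.
    have : P i i0 == 0.
      have := psd_offdiag i i0 psdP; rewrite Pii mul0r => H.
      by rewrite -sqrf_eq0 eq_le H sqr_ge0.
    by move=> /eqP P0i; rewrite /P' vE Pii P0i !mul0r subr0.
  exists i0; rewrite !inE// negbK /P' vE mulfK ?subrr//.
exists (v :: s) => i j; rewrite big_cons -sP' /P'; ring.
Qed.

(** Schur's product theorem: each rank-one term [v i * v j] of [P] contributes the form of [Q] at
    the vector [v i * x i]. *)
Lemma psdM P Q : psd P -> psd Q -> psd (fun i j => P i j * Q i j).
Proof.
move=> psdP [Qsym Q0]; split=> [i j|x].
  by case: psdP => Psym _; rewrite Psym Qsym.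
have [s sP] := psd_sum_rank1 psdP.
have -> : quad (fun i j => P i j * Q i j) x =
    \sum_(v <- s) quad Q (fun i => v i * x i).
  rewrite /quad [RHS]exchange_big; apply: eq_bigr => i _ /=.
  rewrite [RHS]exchange_big; apply: eq_bigr => j _ /=.
  rewrite sP !mulr_suml; apply: eq_bigr => v _; ring.
by apply: sumr_ge0 => v _; exact: Q0.
Qed.

Lemma psd1 : psd (fun _ _ => 1).
Proof.
split=> // x.
have := quad_rank1 (fun=> 1) x; rewrite !mulr1 => ->; exact: sqr_ge0.
Qed.

Lemma psdX P n : psd P -> psd (fun i j => P i j ^+ n).
Proof.
move=> psdP; elim: n => [|n IH]; first exact: psd1.
rewrite [X in psd X](_ : _ = fun i j => P i j * P i j ^+ n); first exact: psdM.
by apply/funext => i; apply/funext => j; rewrite exprS.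
Qed.

End quadratic_forms.

(** * The binomial series of [(1 - t) ^ a] for [|t| < 1] *)

Section binomial_series.
Context {R : realType} (a : R).
Hypotheses (a0 : 0 < a) (a1 : a <= 1).

(* The Taylor coefficients of [(1 - t) `^ a] at [0]. *)
Fixpoint binom_coef n : R :=
  if n is m.+1 then binom_coef m * (m%:R - a) / m.+1%:R else 1.

Definition binom_poly n : {poly R} := \poly_(i < n.+1) binom_coef i.

Lemma binom_coefS n :
  n.+1%:R * binom_coef n.+1 = binom_coef n * (n%:R - a).
Proof. by rewrite /= mulrC divfK// pnatr_eq0. Qed.

Lemma binom_coef1 : binom_coef 1 = - a.
Proof. by rewrite /= mul1r sub0r divr1. Qed.

Lemma binom_coef_le0 n : binom_coef n.+1 <= 0.
Proof.
elim: n => [|n IH]; first by rewrite binom_coef1 oppr_le0 ltW.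
rewrite -(pmulr_rle0 _ (ltr0Sn R n.+1)) binom_coefS mulr_le0_ge0//.
by rewrite subr_ge0 (le_trans a1)// ler1n.
Qed.

(** Each step of the recursion replaces the factor [n + 1] by [n + 1 - a], which is smaller and
    nonnegative. The quantity is the coefficient of the defect in [binom_poly_ode]. *)
Lemma binom_coef_bound n : `|n.+1%:R * binom_coef n.+1| <= 1.
Proof.
elim: n => [|n IH].
  by rewrite binom_coef1 mul1r normrN ger0_norm// ltW.
apply: le_trans IH; rewrite binom_coefS !normrM mulrC ler_wpM2r//.
have n1 : 1 <= n.+1%:R :> R by rewrite ler1n.
have na : 0 <= n.+1%:R - a by rewrite subr_ge0 (le_trans a1).
by rewrite ger0_norm// ger0_norm ?ler0n// gerBl ltW.
Qed.

Lemma binom_polyS n :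
  binom_poly n.+1 = binom_poly n + binom_coef n.+1 *: 'X^(n.+1).
Proof. by rewrite /binom_poly !poly_def big_ord_recr. Qed.

(** The function [(1 - t) ^ a] solves [(1 - t) y' + a y = 0]; for the truncated series everything
    cancels except one monomial, the defect. *)
Lemma binom_poly_ode n (t : R) :
  (1 - t) * (binom_poly n)^`().[t] + a * (binom_poly n).[t] =
  - (n.+1%:R * binom_coef n.+1) * t ^+ n.
Proof.
elim: n => [|n IH].
  rewrite /binom_poly poly_def big_ord_recr big_ord0 /= add0r expr0.
  rewrite alg_polyC derivC !hornerE; lra.
rewrite binom_coefS binom_polyS derivD derivZ derivXn.
rewrite !(hornerD, hornerZ, hornerMn, hornerXn) -pred_Sn.
rewrite -[t ^+ n *+ _]mulr_natr.
transitivity (- (n.+1%:R * binom_coef n.+1) * t ^+ n +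
  (1 - t) * (binom_coef n.+1 * (t ^+ n * n.+1%:R)) +
    a * (binom_coef n.+1 * t ^+ n.+1)); first by rewrite -IH; ring.
by rewrite exprS; ring.
Qed.

Lemma mulr_powR_Nm1 (x : R) : 0 < x -> x * x `^ (- a - 1) = x `^ (- a).
Proof.
move=> x0; have -> : x `^ (- a) = x `^ (1 + (- a - 1)) by congr (_ `^ _); ring.
by rewrite (@powRD _ x 1 (- a - 1)) ?(gt_eqF x0) ?implybT// powRr1 ?ltW.
Qed.

Lemma binom_poly_approx n (r t : R) : 0 <= r < 1 -> `|t| <= r ->
  `|(binom_poly n).[t] - (1 - t) `^ a| <=
  2 `^ a * (1 - r) `^ (- a - 1) * r ^+ n.
Proof.
move=> /andP[r0 r1] tr.
have t1 (s : R) : s \in `[0, 1] -> `|s * t| <= r.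
  rewrite in_itv/= => /andP[s0 s1]; rewrite normrM (ger0_norm s0).
  by apply: le_trans tr; rewrite ler_piMl.
have t1r (s : R) : s \in `[0, 1] -> 1 - r <= 1 - s * t.
  by move=> /t1; rewrite ler_norml => /andP[_ ?]; lra.
have t10 (s : R) : s \in `[0, 1] -> 0 < 1 - s * t.
  by move=> /t1r; apply: lt_le_trans; lra.
(* The Taylor polynomial divided by the function, along the segment from [0] to [t]. It is [1] at
   [s = 0], and its derivative [dG] involves only the defect, so the mean value theorem bounds the
   error. *)
pose G (s : R) := (binom_poly n).[s * t] * (1 - s * t) `^ (- a).
pose dG (s : R) := t * ((1 - s * t) `^ (- a - 1) *
  (- (n.+1%:R * binom_coef n.+1) * (s * t) ^+ n)).
have dGE (s : R) : s \in `[0, 1] -> is_derive s 1 G (dG s).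
  move=> s01; have s0 := t10 s s01.
  have st : is_derive s 1 (fun s : R => s * t) t.
    by apply: is_derive_eq; rewrite scaler0 add0r /GRing.scale/= mulr1.
  have st' : is_derive s 1 (fun s : R => 1 - s * t) (- t).
    by apply: is_derive_eq; rewrite add0r mul1r.
  have H1 := @is_derive1_comp R (horner (binom_poly n)) (fun s : R => s * t) s
    _ _ (is_derive_poly (binom_poly n) (s * t)) st.
  have H2 := @is_derive1_comp R ((@powR R)^~ (- a)) (fun s : R => 1 - s * t) s
    _ _ (is_derive1_powR (- a) s0) st'.
  have H : is_derive s 1 G _ := is_deriveM H1 H2.
  apply: (is_derive_eq H).
  rewrite /dG -binom_poly_ode /GRing.scale/=.
  rewrite -(mulr_powR_Nm1 s0).
  by ring.
have Gcont : {within `[0, 1], continuous G}.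
  by apply: derivable_within_continuous => s /dGE dGs; exact: ex_derive.
have dGoo (s : R) : s \in `]0, 1[ -> is_derive s 1 G (dG s).
  by move=> s01; apply: dGE; exact: subset_itv_oo_cc.
have [c c01 Gc] := MVT_segment ler01 dGoo Gcont.
have tc := t10 c c01.
have t0 : 0 < 1 - t.
  by have := t10 1; rewrite mul1r; apply; rewrite in_itv/= lexx ler01.
have wE : (1 - t) `^ (- a) * (1 - t) `^ a = 1.
  by rewrite -powRD ?(gt_eqF t0) ?implybT// addNr powRr0.
have -> : (binom_poly n).[t] - (1 - t) `^ a = (1 - t) `^ a * dG c.
  move: Gc; rewrite /G mul1r mul0r subr0 powR1 !mulr1 => <-.
  rewrite {1}/binom_poly horner_coef0 coef_poly/=.
  by rewrite mulrBr mulrCA [X in _ * X - _]mulrC wE !mulr1.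
rewrite normrM -mulrA ler_pM//.
  rewrite ger0_norm ?powR_ge0//; apply: ge0_ler_powR; rewrite ?nnegrE ?ltW//.
  by move: tr; rewrite ler_norml => /andP[]; lra.
rewrite /dG mulrCA normrM ler_pM//.
  have r1' : 0 < 1 - r by rewrite subr_gt0.
  rewrite ger0_norm ?powR_ge0// -opprD !powRN lef_pV2 ?posrE ?powR_gt0//.
  by apply: ge0_ler_powR; rewrite ?nnegrE ?t1r//; apply: ltW => //;
    exact: addr_gt0.
rewrite mulrCA normrM normrN -[leRHS]mul1r ler_pM ?binom_coef_bound//.
rewrite normrM -[leRHS]mul1r; apply: ler_pM => //.
  exact: le_trans tr (ltW r1).
by rewrite normrX; apply: lerXn2r; rewrite ?nnegrE ?t1.
Qed.

Lemma binom_poly_cvg (t : R) : `|t| < 1 ->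
  (binom_poly n).[t] @[n --> \oo] --> (1 - t) `^ a.
Proof.
move=> t1; pose C := 2 `^ a * (1 - `|t|) `^ (- a - 1).
have /cvgrPdist_le C0 : geometric C `|t| x @[x --> \oo] --> 0.
  by apply: cvg_geometric; rewrite normr_id.
apply/cvgrPdist_le => e /C0; apply: filterS => n; rewrite sub0r normrN => Cn.
rewrite distrC (le_trans (@binom_poly_approx n `|t| t _ _)) ?normr_ge0//.
exact: le_trans (ler_norm _) Cn.
Qed.

End binomial_series.

(** * Limits of quadratic forms and the bound for powers of [1 - P] *)

Section quadratic_limits.
Context {R : realType}.

Lemma cvgr_sum (T : Type) (F : set_system T) (FF : Filter F) (J : Type)
    (r : seq J) (f : J -> T -> R) (l : J -> R) :
  (forall j, f j x @[x --> F] --> l j) ->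
  \sum_(j <- r) f j x @[x --> F] --> \sum_(j <- r) l j.
Proof.
move=> fl; elim: r => [|j r IH].
  by rewrite big_nil; under eq_fun do rewrite big_nil; exact: cvg_cst.
by rewrite big_cons; under eq_fun do rewrite big_cons; exact: cvgD.
Qed.

Lemma cvg_quad (T : Type) (F : set_system T) (FF : Filter F) (I : finType)
    (f : T -> I -> I -> R) (l : I -> I -> R) (g : I -> R) :
  (forall i j, f x i j @[x --> F] --> l i j) ->
  quad (f x) g @[x --> F] --> quad l g.
Proof.
move=> fl; apply: cvgr_sum => i; apply: cvgr_sum => j.
by apply: cvgMr_tmp; apply: cvgMr_tmp.
Qed.

Lemma powR_onem_cvg (a t : R) : 0 < a -> t <= 1 ->
  (1 - (1 - s) * t) `^ a @[s --> 0^'+] --> (1 - t) `^ a.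
Proof.
move=> a0; rewrite le_eqVlt => /predU1P[->|t1].
  (* For [t = 1] the base is [s] itself and tends to [0], outside the range where the power is
     differentiated below. *)
  rewrite subrr powR0 ?gt_eqF//.
  under eq_fun do rewrite mulr1 opprB addrC subrK.
  exact: powR_cvg0.
have t0 : 0 < 1 - t by rewrite subr_gt0.
have powC : {for 1 - t, continuous (fun x : R => x `^ a)}.
  apply: differentiable_continuous; apply/derivable1_diffP.
  by apply: derivable_powR; rewrite in_itv/= andbT.
apply: (@cvg_comp _ _ _ (fun s : R => 1 - (1 - s) * t) (fun x : R => x `^ a)
  _ (nbhs (1 - t))); last exact: powC.
apply: cvgB; first exact: cvg_cst.
rewrite -[X in _ --> X]mul1r; apply: cvgMr_tmp; rewrite -[X in _ --> X]subr0.
by apply: cvgB; [exact: cvg_cst|exact: cvg_at_right_filter].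
Qed.

Context (I : finType) (a : R) (P : I -> I -> R) (g : I -> R).
Hypotheses (a0 : 0 < a) (a1 : a <= 1) (psdP : psd P) (g0 : \sum_i g i = 0).

(* Beyond the linear term the series of [(1 - t) `^ a] has nonpositive
   coefficients, so by Schur's theorem it only decreases the form. *)
Lemma quad_powR_onem : (forall i j, `|P i j| <= 1) ->
  quad (fun i j => (1 - P i j) `^ a) g <= - a * quad P g.
Proof.
move=> P1.
(* Entries of [P] may have modulus one, while [binom_poly_cvg] asks for less. The factor [1 - s]
   ensures this, and [s] tends to [0] at the end. *)
have : \forall s \near 0^'+,
    quad (fun i j => (1 - (1 - s) * P i j) `^ a) g <=
    - a * ((1 - s) * quad P g).
  near=> s; have s0 : 0 < s by [].
  have s1 : s < 1 by near: s; exact: nbhs_right_lt.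
  pose Q i j := (1 - s) * P i j.
  have psdQ : psd Q.
    case: psdP => Psym P0; split=> [i j|x]; first by rewrite /Q Psym.
    by rewrite quadZ mulr_ge0// subr_ge0 ltW.
  have Q1 i j : `|Q i j| < 1.
    rewrite normrM (le_lt_trans (ler_wpM2l _ (P1 i j)))// mulr1.
    by rewrite ger0_norm; lra.
  have approx n : quad (fun i j => (binom_poly a n.+1).[Q i j]) g <=
      - a * quad Q g.
    elim: n => [|n IH].
      (* The constant term contributes [(\sum_i g i) ^+ 2 = 0], which leaves the linear one. *)
      have -> : quad (fun i j => (binom_poly a 1).[Q i j]) g =
          quad (fun i j => 1 * 1) g + quad (fun i j => - a * Q i j) g.
        rewrite -quadD; apply: eq_bigr => i _; apply: eq_bigr => j _.
        rewrite binom_polyS hornerD hornerZ hornerXn expr1 binom_coef1.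
        by rewrite /binom_poly poly_def big_ord1 hornerZ hornerXn expr0.
      rewrite (quad_rank1 (fun=> 1)) quadZ.
      under eq_bigr do rewrite mul1r.
      by rewrite g0 expr0n/= add0r.
    have -> : quad (fun i j => (binom_poly a n.+2).[Q i j]) g =
        quad (fun i j => (binom_poly a n.+1).[Q i j]) g +
        binom_coef a n.+2 * quad (fun i j => Q i j ^+ n.+2) g.
      rewrite -quadZ -quadD; apply: eq_bigr => i _; apply: eq_bigr => j _.
      by rewrite binom_polyS hornerD hornerZ hornerXn.
    rewrite -[leRHS]addr0 lerD// mulr_le0_ge0//; first exact: binom_coef_le0.
    by case: (psdX n.+2 psdQ).
  rewrite -quadZ.
  apply: (@cvgr_to_le _ (\oo) _ R
    (fun n => quad (fun i j => (binom_poly a n.+1).[Q i j]) g)).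
    apply: cvg_quad => i j.
    by have := binom_poly_cvg a0 a1 (Q1 i j); rewrite -cvg_shiftS.
  by near=> n.
apply: ler_cvg_to.
  apply: cvg_quad => i j; apply: powR_onem_cvg => //.
  by apply: le_trans (P1 i j); exact: ler_norm.
apply: cvgMr; rewrite -[X in _ --> X]mul1r; apply: cvgMl.
rewrite -[X in _ --> X]subr0.
by apply: cvgB; [exact: cvg_cst|exact: cvg_at_right_filter].
Unshelve. all: by end_near. Qed.

End quadratic_limits.

(** * Powers of strictly negative kernels, by way of the bordered kernel *)

Section powers_of_kernels.
Context {R : realType} {I : finType}.

Lemma quad_add_cst (J : finType) (P : J -> J -> R) (x : J -> R) t :
  (forall i j, P i j = P j i) ->
  quad P (fun i => x i + t) =
  quad P x + t * (\sum_i (\sum_j P i j) * x i) *+ 2 +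
  t ^+ 2 * \sum_i \sum_j P i j.
Proof.
move=> Psym.
have -> : \sum_i (\sum_j P i j) * x i = \sum_i \sum_j P i j * x j.
  rewrite exchange_big; apply: eq_bigr => i _; rewrite mulr_suml.
  by apply: eq_bigr => j _; rewrite Psym.
rewrite mulr2n {1}exchange_big !mulr_sumr -!big_split; apply: eq_bigr => i _.
rewrite /= !mulr_sumr -!big_split; apply: eq_bigr => j _ /=.
rewrite (Psym j i); ring.
Qed.

Lemma sum_option (f : option I -> R) :
  \sum_i f i = f None + \sum_i f (Some i).
Proof.
rewrite (bigD1 None)//=; congr (_ + _).
rewrite (reindex_omap Some id); last by case.
by apply: eq_bigl => i; rewrite eqxx.
Qed.

Variable k : I -> I -> R.

(** The border acts as a point at distance one from all others. It makes every row sum positive, and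
    it is unchanged by powers with positive exponent. *)
Definition kernel_ext (i j : option I) : R :=
  match i, j with
  | Some i, Some j => k i j
  | None, None => 0
  | _, _ => 1
  end.

Lemma quad_kernel_ext b : \sum_i b (Some i) = 0 ->
  quad kernel_ext b = quad k (fun i => b (Some i)).
Proof.
move=> b0; rewrite /quad sum_option sum_option /= mul0r mul0r add0r.
rewrite -mulr_sumr b0 mulr0 add0r.
under eq_bigr do rewrite sum_option /= mul1r.
by rewrite big_split /= -mulr_suml b0 mul0r add0r.
Qed.

Hypotheses (ksym : forall i j, k i j = k j i) (k0 : forall i, k i i = 0).
Hypothesis k_ge0 : forall i j, 0 <= k i j.
Hypothesis k_neg : forall b, \sum_i b i = 0 -> ~ (forall i, b i = 0) ->
  quad k b < 0.
Hypothesis I_gt0 : (0 < #|I|)%N.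

Let K := kernel_ext.
Let x i := \sum_j K i j.
Let S := \sum_i x i.

Let Ksym i j : K i j = K j i.
Proof. by case: i j => [i|] [j|] /=. Qed.

Let xN : x None = #|I|%:R.
Proof. by rewrite /x sum_option /= add0r sumr_const. Qed.

Let x_gt0 i : 0 < x i.
Proof.
case: i => [i|]; last by rewrite xN ltr0n.
by rewrite /x sum_option /= ltr_pwDl// sumr_ge0.
Qed.

Let S_gt0 : 0 < S.
Proof.
by rewrite /S sum_option ltr_pwDl// sumr_ge0// => i _; exact: ltW.
Qed.

Let quad_k_le0 b : \sum_i b i = 0 -> quad k b <= 0.
Proof.
move=> b0; have [bz|bnz] := pselect (forall i, b i = 0); last exact/ltW/k_neg.
by rewrite /quad big1// => i _; apply: big1 => j _; rewrite bz mulr0 mul0r.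
Qed.

(** If the part of [b] on [I] sums to zero, the form reduces to that of [k]. Otherwise a constant
    [t] is added to reach this case: by orthogonality to [x] there is no cross term, so the form
    grows by [t ^+ 2 * S > 0] and still ends up nonpositive. *)
Let quad_K_lt0 b : \sum_i x i * b i = 0 -> ~ (forall i, b i = 0) ->
  quad K b < 0.
Proof.
move=> xb bnz; set s := \sum_i b (Some i).
have [s0|s0] := eqVneq s 0.
  rewrite quad_kernel_ext//; apply: k_neg => // bS; apply: bnz.
  have : x None * b None == 0.
    move: xb; rewrite sum_option [X in _ + X]big1 ?addr0 => [->//|i _].
    by rewrite bS mulr0.
  by rewrite mulf_eq0 gt_eqF//= => /eqP bN [i|].
pose t := - s / #|I|%:R.
have n0 : #|I|%:R != 0 :> R by rewrite pnatr_eq0 -lt0n.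
have bt0 : \sum_i (b (Some i) + t) = 0.
  by rewrite big_split /= sumr_const -/s -mulr_natr divfK// subrr.
have := quad_k_le0 bt0.
rewrite -(@quad_kernel_ext (fun i => b i + t))// quad_add_cst// -/K.
rewrite -/x xb mulr0 mul0rn addr0 => le0.
have : 0 < t ^+ 2 * S.
  by rewrite mulr_gt0// exprn_even_gt0//= mulf_neq0 ?oppr_eq0 ?invr_eq0.
by move: le0; rewrite -/S; lra.
Qed.

(* The reversed Cauchy-Schwarz inequality against the constant vector [1]. *)
Let quad_K_le b : S * quad K b <= (\sum_i x i * b i) ^+ 2.
Proof.
set L := \sum_i _; pose t := - L / S.
have xbt : \sum_i x i * (b i + t) = 0.
  under eq_bigr do rewrite mulrDr.
  by rewrite big_split /= -mulr_suml -/S mulrCA divff ?gt_eqF// mulr1 subrr.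
have : quad K (fun i => b i + t) <= 0.
  have [bz|bnz] := pselect (forall i, b i + t = 0); last exact/ltW/quad_K_lt0.
  by rewrite /quad big1// => i _; apply: big1 => j _; rewrite bz mulr0 mul0r.
rewrite quad_add_cst// -/x -/L -/S -(pmulr_rle0 _ S_gt0) => H.
rewrite -subr_le0; apply: le_trans H; rewrite le_eqVlt; apply/orP; left.
by apply/eqP; rewrite /t; field; rewrite gt_eqF.
Qed.

Let P i j := 1 - S * ((x i)^-1 * (x j)^-1 * K i j).

Let quadP b :
  quad P b = (\sum_i b i) ^+ 2 - S * quad K (fun i => (x i)^-1 * b i).
Proof.
rewrite /P (quadB (fun=> fun=> 1)) quadZ quad_scale.
have := quad_rank1 (fun=> 1) b; rewrite mulr1 => ->.
by under eq_bigr do rewrite mul1r.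
Qed.

(** This is [quad_K_le] after rescaling the vector by [x]. *)
Let psdP : psd P.
Proof.
split=> [i j|b]; first by rewrite /P Ksym [_^-1 * _]mulrC.
rewrite quadP subr_ge0; apply: le_trans (quad_K_le _) _.
by under eq_bigr do rewrite mulVKf ?gt_eqF//.
Qed.

(** The zero diagonal of [K] makes the diagonal of [P] equal to one, and semidefiniteness then
    bounds the other entries. *)
Let P_le1 i j : `|P i j| <= 1.
Proof.
have P1 l : P l l = 1.
  by case: l => [l|]; rewrite /P /K /= ?k0 !mulr0 subr0.
have := psd_offdiag i j psdP; rewrite !P1 mulr1.
by rewrite -[X in X <= _]real_normK ?num_real// expr_le1.
Qed.

Lemma quad_powR_lt0 a b : 0 < a -> a <= 1 -> \sum_i b i = 0 ->
  ~ (forall i, b i = 0) -> quad (fun i j => k i j `^ a) b < 0.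
Proof.
move=> a0 a1 b0 bnz.
pose xa i := x i `^ a.
have xa_gt0 i : 0 < xa i by exact: powR_gt0.
(* The border value is chosen so that [g] sums to zero. It is free: since [b] sums to zero, the row
   and column of ones contribute nothing to the form. *)
pose c i := if i is Some i then b i else
  - (\sum_i xa (Some i) * b i) / xa None.
pose g i := xa i * c i.
have g0 : \sum_i g i = 0.
  by rewrite sum_option /g /= mulrC divfK ?gt_eqF// addNr.
have -> : quad (fun i j => k i j `^ a) b = quad (fun i j => K i j `^ a) c.
  rewrite /quad sum_option sum_option /= powR0 ?gt_eqF// !mul0r add0r powR1.
  under [X in _ = X + _]eq_bigr do rewrite mul1r.
  rewrite -mulr_sumr b0 mulr0 add0r.
  under [RHS]eq_bigr do rewrite sum_option /= powR1 mul1r.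
  by rewrite big_split /= -mulr_suml b0 mul0r add0r.
rewrite -(pmulr_rlt0 _ (powR_gt0 a S_gt0)) -quadZ.
have -> : quad (fun i j => S `^ a * K i j `^ a) c =
    quad (fun i j => (1 - P i j) `^ a) g.
  rewrite -[RHS]quad_scale; congr (quad _ c).
  apply/funext => i; apply/funext => j.
  have K_ge0 : 0 <= K i j by case: i j => [i|] [j|] /=.
  have Sx : 0 <= S * ((x i)^-1 * (x j)^-1 * K i j).
    by rewrite !mulr_ge0// ?invr_ge0 ltW.
  have -> : 1 - P i j = S * ((x i)^-1 * (x j)^-1 * K i j).
    by rewrite /P opprB addrC subrK.
  have xx := mulr_ge0 (ltW (x_gt0 i)) (ltW (x_gt0 j)).
  rewrite /xa -(powRM a (ltW S_gt0) K_ge0).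
  rewrite -(powRM a (ltW (x_gt0 i)) (ltW (x_gt0 j))) -(powRM a xx Sx).
  by congr (_ `^ _); field; rewrite !gt_eqF.
apply: le_lt_trans (quad_powR_onem a0 a1 psdP g0 P_le1) _.
(* Since [g] sums to zero, [quad P g] is [- S] times the form of [K] at [g / x], a non-zero vector
   orthogonal to [x]. *)
rewrite nmulr_rlt0 ?oppr_lt0// quadP g0 expr0n/= sub0r oppr_gt0 pmulr_rlt0//.
apply: quad_K_lt0.
  by rewrite -[RHS]g0; apply: eq_bigr => i _; rewrite mulVKf ?gt_eqF.
move=> gz; apply: bnz => i; have /eqP := gz (Some i).
by rewrite /g /= !mulf_eq0 invr_eq0 (gt_eqF (x_gt0 _)) (gt_eqF (xa_gt0 _))
  => /eqP.
Qed.

End powers_of_kernels.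

(** The kernel [d ^ p] is the power of [d ^ q] with exponent [p / q], which lies in [(0, 1]]. *)
Lemma strict_negative_type_le (R : realType) (X : metricType R) (p q : R) :
  0 < p -> p <= q -> strict_negative_type X q ->
  forall (n : nat) (z : 'I_n -> X) (alpha : 'I_n -> R),
    injective z -> \sum_(i < n) alpha i = 0 -> ~ (forall i, alpha i = 0) ->
    \sum_(j < n) \sum_(i < n)
      mdist (z j) (z i) `^ p * alpha j * alpha i < 0.
Proof.
move=> p0 pq [_ Xq] n z alpha zinj alpha0 alpha_neq0.
have q0 : 0 < q by exact: lt_le_trans pq.
pose k i j := mdist (z i) (z j) `^ q.
have kE i j : mdist (z i) (z j) `^ p = k i j `^ (p / q).
  by rewrite /k -powRrM mulrC divfK ?gt_eqF.
rewrite [ltLHS](_ : _ = quad (fun i j => k i j `^ (p / q)) alpha); last first.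
  by apply: eq_bigr => i _; apply: eq_bigr => j _; rewrite kE.
apply: quad_powR_lt0 => //.
- by move=> i j; rewrite /k metric_sym.
- by move=> i; rewrite /k mdistxx powR0 ?gt_eqF.
- by move=> i j; exact: powR_ge0.
- by move=> b b0 bnz; exact: Xq.
- rewrite card_ord; case: n z alpha zinj alpha0 alpha_neq0 k kE => //.
  move=> z alpha _ _.
  by case=> -[].
- by rewrite divr_gt0.
- by rewrite ler_pdivrMr// mul1r.
Qed.

(** * Weights of a signed simplex, collected point by point *)

Section simplex_weights.
Context {R : realType} {Y : eqType}.

Lemma sum_fibers (J : finType) (x : J -> Y) (m : J -> R) (r : seq Y)
    (g : Y -> R) : uniq r -> (forall j, x j \in r) ->
  \sum_(z <- r) g z * (\sum_(j | x j == z) m j) = \sum_j g (x j) * m j.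
Proof.
move=> ur xr; under eq_bigr do rewrite mulr_sumr big_mkcond.
rewrite exchange_big; apply: eq_bigr => j _ /=.
rewrite (bigD1_seq (x j))//= eqxx big1 ?addr0// => z zx.
by rewrite eq_sym (negPf zx).
Qed.

Variable D : signed_simplex R Y.

(** Repetitions are removed because negative type is tested on distinct points. *)
Definition splx_support : seq Y :=
  undup (codom (@splx_x _ _ D) ++ codom (@splx_y _ _ D)).

Lemma splx_supportP z : z \in splx_support <-> splx_points D z.
Proof.
rewrite mem_undup mem_cat; split.
  by case/orP => /codomP[i ->]; [left|right]; exists i.
by case=> -[i _ <-]; rewrite codom_f ?orbT.
Qed.

Lemma sum_splx_support (g : Y -> R) :
  \sum_(z <- splx_support) g z * (splx_mweight D z - splx_nweight D z) =
  \sum_j g (@splx_x _ _ D j) * splx_m j - \sum_i g (@splx_y _ _ D i) * splx_n i.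
Proof.
under eq_bigr do rewrite mulrBr.
rewrite sumrB /splx_mweight /splx_nweight !sum_fibers ?undup_uniq//.
- by move=> i; rewrite mem_undup mem_cat codom_f orbT.
- by move=> i; rewrite mem_undup mem_cat codom_f.
Qed.

Lemma degenerate_sum (g : Y -> R) : degenerate D ->
  \sum_j g (@splx_x _ _ D j) * splx_m j = \sum_i g (@splx_y _ _ D i) * splx_n i.
Proof.
move=> dD; apply/eqP; rewrite -subr_eq0 -sum_splx_support big_seq.
by apply/eqP; apply: big1 => z /splx_supportP/dD ->; rewrite subrr mulr0.
Qed.

Lemma splx_weights_balanced :
  \sum_(z <- splx_support) (splx_mweight D z - splx_nweight D z) = 0.
Proof.
have := sum_splx_support (fun=> 1).
under eq_bigr do rewrite mul1r.
move=> ->; under eq_bigr do rewrite mul1r.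
under [X in _ - X]eq_bigr do rewrite mul1r.
by rewrite splx_balanced subrr.
Qed.

End simplex_weights.

Lemma sum_integral_ae0 d (T : measurableType d) (R : realType)
    (mu : {measure set T -> \bar R}) (J : Type) (r : seq J) (a : J -> R)
    (h : J -> T -> R) :
  (forall j, mu.-integrable setT (EFin \o h j)) ->
  {ae mu, forall w, \sum_(j <- r) a j * h j w = 0} ->
  \sum_(j <- r) a j * fine (\int[mu]_w (h j w)%:E) = 0.
Proof.
move=> hint h0; apply: EFin_inj; rewrite -sumEFin.
have ahint j : mu.-integrable setT (fun w => ((a j)%:E * (h j w)%:E)%E).
  by apply: integrableZl => //; exact: hint.
transitivity (\sum_(j <- r) \int[mu]_w ((a j)%:E * (h j w)%:E))%E.
  apply: eq_bigr => j _; rewrite EFinM fineK; last first.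
    exact: integrable_fin_num (hint j).
  by rewrite integralZl//; exact: hint.
rewrite -integral_sum// (@ae_eq_integral _ _ _ mu setT (cst 0%E))//.
- by rewrite integral0.
- by apply: measurable_int; apply: integrable_sum.
- apply: filterS h0 => w h0 _.
  by under eq_bigr do rewrite -EFinM; rewrite sumEFin h0.
Qed.

(** * Distances in L_p and virtually degenerate simplices *)

Section Lp_geometry.
Context (R : realType) (F : scalar_kind) (d : measure_display)
  (T : measurableType d) (mu : {measure set T -> \bar R}) (p : R) (p0 : 0 < p).
Local Notation LP := (Lp F mu p0).
Implicit Types (x y z u v : LP) (D : signed_simplex R LP).

Lemma Lp_integral_lty x : (\int[mu]_w (modulus (x w) `^ p)%:E < +oo)%E.
Proof.
by apply/(finite_norm_modulusP mu p0); exact: Lp_function_finite.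
Qed.

Lemma Lp_integrable x :
  mu.-integrable setT (EFin \o (fun w => modulus (x w) `^ p)).
Proof.
apply/integrableP; split.
  exact: measurable_modulus_powR (Lp_function_measurable _).
under eq_integral do rewrite /= ger0_norm ?powR_ge0//.
exact: Lp_integral_lty.
Qed.

Lemma Lp_norm_ge0 x : 0 <= Lp_norm x.
Proof. by apply: fine_ge0; exact: Lnorm_ge0. Qed.

Lemma Lp_norm_powR x :
  Lp_norm x `^ p = fine (\int[mu]_w (modulus (x w) `^ p)%:E).
Proof.
have fN : ('N[mu]_p%:E[EFin \o (@modulus R F \o x)])%E \is a fin_num.
  rewrite ge0_fin_numE ?Lnorm_ge0//.
  exact: Lp_function_finite.
have := poweR_Lnorm mu (EFin \o (@modulus R F \o x)) (lt0r_neq0 p0).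
rewrite -(fineK fN) -/(Lp_norm x) poweR_EFin => /(congr1 fine) /= ->.
congr fine; apply: eq_integral => w _.
by rewrite ger0_norm ?modulus_ge0.
Qed.

(** The integral gives the equality of the [p]-th powers, and the roots are taken at the end. *)
Lemma Lp_normZ (a : Defs.scalar R F) x :
  Lp_norm (a *: x) = modulus a * Lp_norm x.
Proof.
have H : Lp_norm (a *: x) `^ p = (modulus a * Lp_norm x) `^ p.
  rewrite powRM ?modulus_ge0 ?Lp_norm_ge0// !Lp_norm_powR.
  rewrite -[modulus a `^ p]/(fine (modulus a `^ p)%:E) -fineM//; last first.
    rewrite ge0_fin_numE ?Lp_integral_lty//.
    by apply: integral_ge0 => w _; rewrite lee_fin powR_ge0.
  congr fine; rewrite -ge0_integralZl//.
  - apply: ae_eq_integral => //.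
    + exact: measurable_modulus_powR (Lp_function_measurable _).
    + under eq_fun do rewrite -EFinM.
      apply/measurable_EFinP; apply: measurable_funM => //.
      by apply/measurable_EFinP;
        exact: measurable_modulus_powR (Lp_function_measurable _).
    + apply: filterS (Lp_scaleE a x) => w -> _.
      by rewrite modulusM powRM ?modulus_ge0.
  - exact: measurable_modulus_powR (Lp_function_measurable _).
  - by move=> w _; rewrite lee_fin powR_ge0.
  - by rewrite lee_fin powR_ge0.
have pp : p * p^-1 = 1 by rewrite divff// gt_eqF.
rewrite -[LHS]powRr1 ?Lp_norm_ge0// -[RHS]powRr1; last first.
  by rewrite mulr_ge0 ?modulus_ge0 ?Lp_norm_ge0.
by rewrite -pp !powRrM H.
Qed.

Lemma Lp_subE x y : \forall w \ae mu, (x - y : LP) w = x w - y w.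
Proof. by apply: filterS2 (Lp_addE x (- y)) (Lp_oppE y) => w -> ->. Qed.

Lemma Lp_eq0P x : x = 0 <-> {ae mu, forall w, x w = 0}.
Proof.
split=> [->|x0]; first exact: Lp_zeroE.
by apply/Lp_eqP; apply: filterS2 x0 (Lp_zeroE F mu p0) => w -> ->.
Qed.

Lemma virtually_degenerate_sum D (J := splx_support D)
    (c := fun z => splx_mweight D z - splx_nweight D z) :
  virtually_degenerate D ->
  \sum_(z <- J) \sum_(z' <- J) Lp_dist z z' `^ p * c z * c z' = 0.
Proof.
move=> [_ vD].
transitivity (\sum_(zz <- [seq (z, z') | z <- J, z' <- J]) c zz.1 * c zz.2 *
    fine (\int[mu]_w (modulus ((zz.1 - zz.2 : LP) w) `^ p)%:E)).
  rewrite big_allpairs; apply: eq_bigr => z _; apply: eq_bigr => z' _.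
  by rewrite -Lp_norm_powR [RHS]mulrC mulrA.
apply: (sum_integral_ae0 (h := fun zz : LP * LP => fun w =>
    modulus ((zz.1 - zz.2 : LP) w) `^ p)) => [zz|]; first exact: Lp_integrable.
(* Values of a difference are differences of values only almost everywhere. Indexing the points by
   ordinals leaves finitely many exceptional null sets. *)
have subE : {ae mu, forall w, forall i j : 'I_(size J),
    (nth 0 J i - nth 0 J j : LP) w = (nth 0 J i : LP) w - (nth 0 J j : LP) w}.
  apply: filter_forall => i; apply: filter_forall => j.
  exact: Lp_subE.
apply: filterS2 vD subE => w dw subE.
rewrite big_allpairs big_seq; apply: big1 => z zJ.
(* For fixed [z] and [w] the summand depends on [z'] only through its value at [w], so degeneracy of
   the simplex of values makes the inner sum vanish. *)
pose phi t := modulus ((z : LP) w - t) `^ p.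
transitivity (c z * \sum_(z' <- J) phi ((z' : LP) w) * c z').
  rewrite mulr_sumr big_seq [RHS]big_seq; apply: eq_bigr => z' z'J /=.
  have /= := subE (Ordinal (etrans (index_mem z J) zJ))
    (Ordinal (etrans (index_mem z' J) z'J)).
  by rewrite !nth_index// => ->; rewrite mulrA mulrAC.
rewrite (sum_splx_support D (fun z' : LP => phi (z' w))).
by rewrite (degenerate_sum phi dw) subrr mulr0.
Qed.

Lemma not_isometric_virtually_degenerate (X : metricType R) (q : R)
    (Z : set LP) : p <= q -> strict_negative_type X q ->
  admits_virtually_degenerate Z -> ~ isometric_to X Z.
Proof.
move=> pq Xq [D vD DZ] [f [_ _ fsurj] fiso].
pose J := splx_support D; pose n := size J.
have gex (i : 'I_n) : exists a, f a = nth 0 J i.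
  have /splx_supportP/DZ/fsurj[a _ <-] : nth 0 J i \in J by exact: mem_nth.
  by exists a.
pose g i := sval (cid (gex i)).
have gE i : f (g i) = nth 0 J i by exact: svalP (cid (gex i)).
pose c z := splx_mweight D z - splx_nweight D z.
pose alpha (i : 'I_n) := c (nth 0 J i).
have ginj : injective g.
  move=> i j gij; apply/val_inj/eqP.
  rewrite -(nth_uniq 0 (ltn_ord i) (ltn_ord j)) ?undup_uniq//.
  by rewrite -!gE gij.
have alpha0 : \sum_i alpha i = 0.
  by rewrite -[RHS](splx_weights_balanced D) (big_nth 0) big_mkord.
have alpha_neq0 : ~ (forall i, alpha i = 0).
  move=> az; apply: vD.1 => z /splx_supportP zJ; apply/eqP; rewrite -subr_eq0.
  have := az (Ordinal (etrans (index_mem z J) zJ)).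
  by rewrite /alpha /= nth_index// => /eqP.
have := strict_negative_type_le p0 pq Xq ginj alpha0 alpha_neq0.
rewrite -[X in _ < X](virtually_degenerate_sum vD) (big_nth 0) big_mkord.
rewrite (_ : \sum_(j < n) _ = \sum_(i < n) \sum_(z' <- J)
    Lp_dist (nth 0 J i) z' `^ p * c (nth 0 J i) * c z') ?ltxx//.
apply: eq_bigr => i _; rewrite (big_nth 0) big_mkord; apply: eq_bigr => j _.
by rewrite -fiso !gE.
Qed.

(** Where [v] vanishes, both sides of the simplex take the values [x + u] and [x]; where [u]
    vanishes, both take [x + v] and [x]. *)
Lemma virtually_degenerate_disjoint x u v :
  u <> 0 -> v <> 0 -> disjointly_supported u v ->
  exists2 D, virtually_degenerate D &
    splx_points D `<=` [set x + u; x + v; x; x + (u + v)].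
Proof.
move=> u0 v0 uv.
have bal : \sum_(j < 2) (1 : R) = \sum_(i < 2) 1 by [].
pose D := @SignedSimplex R LP 2 2
  (fun j : 'I_2 => if val j is 0 then x + u else x + v)
  (fun i : 'I_2 => if val i is 0 then x else x + (u + v))
  (fun=> 1) (fun=> 1) isT isT bal.
exists D; last first.
  move=> z [] [[[|[|//]] ?] _ <-] /=;
    [by do 3 left|by left; left; right|by left; right|by right].
have addx_eq (y z : LP) : (x + y == x + z) = (y == z).
  by rewrite (inj_eq (addrI x)).
have sum2 (P : pred 'I_2) : \sum_(i < 2 | P i) (1 : R) =
    (if P ord0 then 1 else 0) + (if P (lift ord0 ord0) then 1 else 0).
  by rewrite big_mkcond big_ord_recl big_ord1.
split.
  (* At [x + u] the first weight is at least one, while the second is zero because [u] and [v] are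
     non-zero. *)
  have Dxu : splx_points D (x + u) by left; exists ord0.
  move=> /(_ _ Dxu); rewrite /splx_mweight /splx_nweight !sum2 /=.
  have -> : (x == x + u) = false.
    by rewrite -[X in X == _](addr0 x) addx_eq eq_sym; exact/eqP.
  have -> : (x + (u + v) == x + u) = false.
    by rewrite addx_eq -[X in _ == X]addr0 (inj_eq (addrI u)); exact/eqP.
  by rewrite eqxx; case: ifP => _; lra.
apply: filterS2 uv (filterI (Lp_addE x u) (filterI (Lp_addE x v)
  (filterI (Lp_addE x (u + v)) (Lp_addE u v)))) => w uvw [xu [xv [xuv uvE]]].
move=> c _.
rewrite /splx_mweight /splx_nweight !sum2 /=.
rewrite xu xv xuv uvE.
by case: uvw => ->; rewrite ?addr0 ?add0r// addrC.
Qed.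

End Lp_geometry.

(** * Measurable functions on a set where every measurable set is null or conull *)

Section zero_one.
Context (R : realType) (F : scalar_kind) (d : measure_display)
  (T : measurableType d) (mu : {measure set T -> \bar R}) (S : set T).
Hypothesis S01 : forall A : set T, measurable A ->
  {ae mu, forall w, A w -> ~ S w} \/ {ae mu, forall w, ~ A w -> ~ S w}.
Hypothesis S_neq0 : ~ {ae mu, forall w, ~ S w}.

(* Two points of [S] lying in the same full-measure halves [h < r], for all
   rational [r], have the same image. *)
Lemma ae_cst_real (h : T -> R) : measurable_fun setT h ->
  exists c, {ae mu, forall w, S w -> h w = c}.
Proof.
move=> mh.
pose b (r : rat) := `[< {ae mu, forall w, S w -> h w < ratr r} >].
have bE r : {ae mu, forall w, S w -> (h w < ratr r) = b r}.
  have mA : measurable [set w | h w < ratr r].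
    rewrite -[X in measurable X]setTI.
    rewrite (_ : [set w | _] = h @^-1` `]-oo, ratr r[); first exact: mh.
    by apply/seteqP; split=> w /=; rewrite in_itv.
  have [A0|A1] := S01 mA.
    have bF : b r = false.
      apply/asboolP => hr; apply: S_neq0; apply: filterS2 A0 hr => w A0 hr Sw.
      exact: (A0 (hr Sw)).
    by apply: filterS A0 => w A0 Sw; rewrite bF; apply/negP => /A0.
  have hr : {ae mu, forall w, S w -> h w < ratr r}.
    by apply: filterS A1 => w A1 Sw; apply: contrapT => nA; exact: A1 nA Sw.
  by have -> : b r = true by [exact/asboolP]; apply: filterS hr => w hr /hr ->.
(* The rationals are enumerated by [pickle], so that countably many null sets are discarded at
   once. *)
have H : {ae mu, forall w, forall r, S w -> (h w < ratr r) = b r}.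
  have : {ae mu, forall w, forall n, if unpickle n is Some r then
      S w -> (h w < ratr r) = b r else True}.
    apply: ae_foralln => n; case: (unpickle n) => [r|]; first exact: bE.
    exact: aeW.
  by apply: filterS => w Hw r; have := Hw (pickle r); rewrite pickleK.
have [[w0 [Hw0 Sw0]]|noS] := pselect (exists w0,
    (forall r, S w0 -> (h w0 < ratr r) = b r) /\ S w0); last first.
  by exfalso; apply: S_neq0; apply: filterS H => w Hw Sw; apply: noS; exists w.
exists (h w0); apply: filterS H => w Hw Sw.
apply/eqP; rewrite eq_le !leNgt; apply/andP.
split; apply/negP => /rat_in_itvoo[r]; rewrite in_itv/= => /andP[h1 h2].
  have := Hw r Sw; rewrite -(Hw0 r Sw0) h1 => /idP.
  by rewrite ltNge ltW.
have := Hw r Sw; rewrite -(Hw0 r Sw0) h1 => /esym/idP.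
by rewrite ltNge ltW.
Qed.

Lemma ae_cst_scalar (f : T -> Defs.scalar R F) : scalar_measurable f ->
  exists c, {ae mu, forall w, S w -> f w = c}.
Proof.
case: F f => f; first exact: ae_cst_real.
move=> [/ae_cst_real[a fa] /ae_cst_real[b fb]].
exists (Complex a b); apply: filterS2 fa fb => w fa fb Sw.
by rewrite -(fa Sw) -(fb Sw); case: (f w).
Qed.

End zero_one.

(** * Truncations and the existence of disjointly supported functions *)

Section truncation.
Context (R : realType) (F : scalar_kind) (d : measure_display)
  (T : measurableType d) (mu : {measure set T -> \bar R}) (p : R) (p0 : 0 < p).
Local Notation LP := (Lp F mu p0).
Implicit Types (x y u v : LP).

Lemma measurable_fun_truncate (h : T -> R) (A : set T) : measurable A ->
  measurable_fun setT h ->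
  measurable_fun setT (fun w => if w \in A then h w else 0).
Proof.
move=> mA mh; rewrite (_ : (fun w => _) = (fun w => h w * \1_A w)).
  by apply: measurable_funM => //; exact: measurable_indic.
by apply/funext => w; rewrite indicE; case: ifP => _; rewrite ?mulr1 ?mulr0.
Qed.

Lemma scalar_measurable_truncate (f : T -> Defs.scalar R F) (A : set T) :
  measurable A -> scalar_measurable f ->
  scalar_measurable (fun w => if w \in A then f w else 0).
Proof.
move=> mA; case: F f => f /=; first exact: measurable_fun_truncate.
move=> [f1 f2]; split.
  rewrite (_ : (fun w => _) = fun w => if w \in A then complex.Re (f w) else 0).
    exact: measurable_fun_truncate.
  by apply/funext => w; case: ifP.
rewrite (_ : (fun w => _) = fun w => if w \in A then complex.Im (f w) else 0).
  exact: measurable_fun_truncate.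
by apply/funext => w; case: ifP.
Qed.

Lemma Lp_truncate x (A : set T) : measurable A ->
  exists y : LP, {ae mu, forall w, y w = if w \in A then x w else 0}.
Proof.
move=> mA; pose f w : Defs.scalar R F := if w \in A then x w else 0.
have mf : scalar_measurable f.
  by apply: scalar_measurable_truncate => //; exact: Lp_function_measurable.
have ff : finite_norm mu p%:E (@modulus R F \o f).
  apply/(finite_norm_modulusP mu p0).
  apply: le_lt_trans (Lp_integral_lty x).
  apply: ge0_le_integral => //.
  - by move=> w _; rewrite lee_fin powR_ge0.
  - exact: measurable_modulus_powR.
  - exact: measurable_modulus_powR (Lp_function_measurable _).
  - move=> w _; rewrite lee_fin /f; case: ifP => // _.
    by rewrite modulus0 powR0 ?powR_ge0// gt_eqF.
exists (\pi_LP (LpFunction mf ff))%qT.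
exact: (Lp_piE p0 (LpFunction mf ff)).
Qed.

Lemma exists_disjointly_supported : at_least_two_dimensional LP ->
  exists u v, [/\ u <> 0, v <> 0 & disjointly_supported u v].
Proof.
move=> [x' [y' xy']]; pose x : LP := x'; pose y : LP := y'.
have xy (a b : Defs.scalar R F) : a *: x + b *: y = 0 -> a = 0 /\ b = 0.
  exact: xy'.
move: x y xy => {x' y' xy'} x y xy; apply: contrapT => no.
have disj u v : disjointly_supported u v -> u = 0 \/ v = 0.
  move=> uv; have [->|u0] := pselect (u = 0); first by left.
  have [->|v0] := pselect (v = 0); first by right.
  by exfalso; apply: no; exists u, v.
pose S := [set w | x w <> 0 \/ y w <> 0].
have S01 (A : set T) : measurable A ->
    {ae mu, forall w, A w -> ~ S w} \/ {ae mu, forall w, ~ A w -> ~ S w}.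
  move=> mA; have mA' := measurableC mA.
  have [xA xAE] := Lp_truncate x mA; have [yA yAE] := Lp_truncate y mA.
  have [xB xBE] := Lp_truncate x mA'; have [yB yBE] := Lp_truncate y mA'.
  have inA (w : T) : (w \in ~` A) = ~~ (w \in A) by rewrite in_setC.
  have key (a b a' b' : LP) :
      {ae mu, forall w, a w = if w \in A then b w else 0} ->
      {ae mu, forall w, a' w = if w \in ~` A then b' w else 0} ->
      a = 0 \/ a' = 0.
    move=> aE bE; apply: disj; apply: filterS2 aE bE => w -> ->.
    by rewrite inA; case: (w \in A); [right|left].
  have vanish (B : set T) (a b : LP) :
      {ae mu, forall w, a w = if w \in B then x w else 0} ->
      {ae mu, forall w, b w = if w \in B then y w else 0} ->
      a = 0 -> b = 0 -> {ae mu, forall w, B w -> ~ S w}.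
    move=> aE bE /Lp_eq0P a0 /Lp_eq0P b0.
    apply: filterS2 (filterI aE a0) (filterI bE b0) => w [aw a0w] [bw b0w] Bw.
    have wB : w \in B by rewrite inE.
    by move: aw bw; rewrite wB a0w b0w => /esym xw /esym yw [].
  (* If both truncations to [A] vanish, [S] misses [A]. Otherwise the non-zero one forces both
     truncations to the complement to vanish. *)
  have [x0|x0] := pselect (xA = 0).
    have [y0|y0] := pselect (yA = 0); first by left; exact: (vanish _ xA yA).
    by right; apply: (vanish _ xB yB) => //;
      [case: (key _ _ _ _ yAE xBE)|case: (key _ _ _ _ yAE yBE)].
  by right; apply: (vanish _ xB yB) => //;
    [case: (key _ _ _ _ xAE xBE)|case: (key _ _ _ _ xAE yBE)].
have x_neq0 : x <> 0.
  move=> x0; have [] := xy 1 0; first by rewrite x0 scaler0 scale0r addr0.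
  by move/eqP; rewrite oner_eq0.
have S_neq0 : ~ {ae mu, forall w, ~ S w}.
  move=> S0; apply: x_neq0; apply/Lp_eq0P; apply: filterS S0 => w Sw.
  by apply: contrapT => xw; apply: Sw; left.
have [c1 xc] := ae_cst_scalar S01 S_neq0 (Lp_function_measurable (repr x)).
have [c2 yc] := ae_cst_scalar S01 S_neq0 (Lp_function_measurable (repr y)).
(* On [S] the functions are the constants [c1] and [c2], and off [S] both vanish, so this
   combination is zero. Independence then gives [c1 = 0], hence [x = 0]. *)
have [] := xy c2 (- c1).
  apply/Lp_eq0P.
  apply: filterS3 (filterI xc yc) (Lp_addE (c2 *: x) (- c1 *: y))
    (filterI (Lp_scaleE c2 x) (Lp_scaleE (- c1) y)).
  move=> w [xw yw] -> [-> ->].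
  have [Sw|Sw] := pselect (S w).
    have -> : x w = c1 by exact: xw.
    have -> : y w = c2 by exact: yw.
    by rewrite mulNr mulrC subrr.
  have -> : x w = 0 by apply: contrapT => h; apply: Sw; left.
  have -> : y w = 0 by apply: contrapT => h; apply: Sw; right.
  by rewrite !mulr0 addr0.
move=> _ /eqP; rewrite oppr_eq0 => /eqP c10; apply: x_neq0.
apply/Lp_eq0P; apply: filterS xc => w xw.
by apply: contrapT => h; apply: (h); rewrite -c10; apply: xw; left.
Qed.

Lemma exists_modulus (t : R) : 0 < t ->
  exists2 a : Defs.scalar R F, a != 0 & modulus a = t.
Proof.
move=> t0; case: F; first by exists t; rewrite ?gt_eqF//= ger0_norm// ltW.
exists (Complex t 0); first by rewrite eq_complex/= gt_eqF.
by rewrite /= expr0n/= addr0 sqrtr_sqr ger0_norm// ltW.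
Qed.

End truncation.

Theorem theorem4p15 (R : realType) (F : scalar_kind)
    (d : measure_display) (T : measurableType d)
    (mu : {measure set T -> \bar R}) (p : R) (p0 : 0 < p)
    (mu_nontrivial : mu [set: T] <> 0%E)
    (Lp_dim2 : at_least_two_dimensional (Lp F mu p0))
    (X : metricType R) (q : R) (pq : p <= q)
    (Xq : strict_negative_type X q) :
  [/\ forall Z : set (Lp F mu p0),
        admits_virtually_degenerate Z -> ~ isometric_to X Z,
      forall W : set (Lp F mu p0),
        GRing.submod_closed (mem W) ->
        (exists x y : Lp F mu p0, [/\ W x, W y, x <> 0, y <> 0 &
           disjointly_supported x y]) ->
        ~ isometric_to X W &
      forall Z : set (Lp F mu p0), Z° !=set0 -> ~ isometric_to X Z].
Proof.
have part1 := @not_isometric_virtually_degenerate R F d T mu p p0 X q.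
split=> [Z|W [W0 Wlin] [x [y [Wx Wy x0 y0 xy]]]|Z [x /= Zx]].
- exact: part1.
- apply: part1 => //.
  (* With base point [0] the vertices are [x], [y], [0] and [x + y], all in the subspace. *)
  have [D vD DW] := virtually_degenerate_disjoint 0 x0 y0 xy.
  exists D => // z /DW; rewrite !add0r.
  have Wxy : W (x + y).
    have := Wlin 1 x y (mem_set Wx) (mem_set Wy).
    by rewrite scale1r => /set_mem.
  move=> /= [[[->|->]|->]|->] //; exact: set_mem.
- apply: part1 => //.
  have [u [v [u0 v0 uv]]] := exists_disjointly_supported Lp_dim2.
  have oZ : Lp_open (Z°) by rewrite -Lp_openE; exact: open_interior.
  have [e e0 eZ] := oZ x Zx.
  (* This exceeds the norms of all three displacements, so a scalar of modulus [e / N] brings them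
     into the ball by homogeneity alone, with no triangle inequality, which fails in general for
     [p < 1]. *)
  pose N : R := 1 + (Lp_norm u + Lp_norm v + Lp_norm (u + v)).
  have nu := Lp_norm_ge0 u; have nv := Lp_norm_ge0 v.
  have nuv := Lp_norm_ge0 (u + v).
  have N0 : 0 < N by rewrite /N; lra.
  have [a a0 aE] := exists_modulus F (divr_gt0 e0 N0).
  (* The sign is chosen so that the difference measured from the centre [x] is [a *: z]. *)
  have ballZ (z : Lp F mu p0) : Lp_norm z < N -> Z (x + (- a) *: z).
    move=> zN; apply: interior_subset; apply: eZ; rewrite /= /Lp_dist.
    rewrite opprD addrA subrr add0r scaleNr opprK Lp_normZ aE.
    by rewrite -mulrA gtr_pMr// mulrC ltr_pdivrMr// mul1r.
  have aneq0 (z : Lp F mu p0) : z <> 0 -> (- a) *: z <> 0.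
    by move=> z0 /eqP; rewrite scaler_eq0 oppr_eq0 (negPf a0)/= => /eqP.
  have auv : disjointly_supported (- a *: u) (- a *: v).
    apply: filterS3 uv (Lp_scaleE (- a) u) (Lp_scaleE (- a) v).
    by move=> w [] h -> ->; rewrite h mulr0; [left|right].
  have [D vD DZ] := virtually_degenerate_disjoint x
    (aneq0 u u0) (aneq0 v v0) auv.
  exists D => // z /DZ /= [[[->|->]|->]|->].
  + by apply: ballZ; rewrite /N; lra.
  + by apply: ballZ; rewrite /N; lra.
  + exact: interior_subset.
  + by rewrite -scalerDr; apply: ballZ; rewrite /N; lra.
Qed.
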